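(* Let $S\subseteq\mathbb R^n$ be a finite set of points and $I=\mathcal I(S)$. Then $I$ is $\mathrm{TH}_1$-exact if and only if for each facet $F$ of the polytope $\operatorname{conv}(S)$ (facets taken relative to the affine hull of $S$) there exists a hyperplane $H$ of the affine hull of $S$ parallel to the affine hull of $F$ such that $S\subseteq F\cup H$; i.e. if and only if $\operatorname{conv}(S)$ is a $2$-level polytope with vertex set $S$.
   Context: For $S\subseteq\mathbb R^n$, $\mathcal I(S)$ is the ideal of all polynomials vanishing on $S$, and $\mathcal V_{\mathbb R}(I)$ is the real zero set of an ideal $I$. $\mathbb{R}[\mathbf x]_k$ denotes the polynomials of degree at most $k$. A polynomial $h$ is $k$-sos modulo $I$ if there are $g_1,\dots,g_r\in\mathbb{R}[\mathbf x]_k$ with $h-\sum_i g_i^2\in I$. The $k$-th theta body is $\mathrm{TH}_k(I)=\{p\in\mathbb R^n: l(p)\ge 0$ for every $l\in\mathbb{R}[\mathbf x]_1$ that is $k$-sos modulo $I\}$. $I$ is $\mathrm{TH}_k$-exact if $\mathrm{TH}_k(I)=\operatorname{cl}(\operatorname{conv}(\mathcal V_{\mathbb R}(I)))$. A polytope $P$ is $k$-level if for every facet $F$ of $P$ and the supporting hyperplane $H$ of $F$ there are $k-1$ hyperplanes $H_1,\dots,H_{k-1}$ parallel to $H$ such that all vertices of $P$ lie in $H\cup H_1\cup\dots\cup H_{k-1}$. *)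

(* Defs.v *)
From HB Require Import structures.
From mathcomp Require Import all_boot all_order all_algebra.
Set Implicit Arguments. Unset Strict Implicit. Unset Printing Implicit Defensive.
Import Order.TTheory GRing.Theory Num.Theory.
Local Open Scope ring_scope.

Section Defs.
Variables (R : rcfType) (n : nat).
Local Notation pt := 'rV[R]_n.

(* Polynomial functions R^n -> R of degree at most k (R[x]_k).  Over an
   infinite field polynomials and polynomial functions are identified. *)
Inductive polyfun_deg : nat -> (pt -> R) -> Prop :=
| pf_const (c : R) : polyfun_deg 0 (fun _ => c)
| pf_coord (i : 'I_n) : polyfun_deg 1 (fun x => x ord0 i)
| pf_add k f g : polyfun_deg k f -> polyfun_deg k g ->
    polyfun_deg k (fun x => f x + g x)
| pf_mul k l f g : polyfun_deg k f -> polyfun_deg l g ->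
    polyfun_deg (k + l) (fun x => f x * g x)
| pf_weaken k l f : (k <= l)%N -> polyfun_deg k f -> polyfun_deg l f.

Definition is_polyfun (f : pt -> R) : Prop := exists k, polyfun_deg k f.

Definition vanishing_ideal (S : pt -> Prop) : (pt -> R) -> Prop :=
  fun f => is_polyfun f /\ forall x, S x -> f x = 0.

Definition real_zero_set (I : (pt -> R) -> Prop) : pt -> Prop :=
  fun x => forall f, I f -> f x = 0.

Definition k_sos_mod (I : (pt -> R) -> Prop) (k : nat) (h : pt -> R) : Prop :=
  exists (r : nat) (g : 'I_r -> pt -> R), (forall i, polyfun_deg k (g i)) /\
    I (fun x => h x - \sum_(i < r) (g i x) ^+ 2).

Definition theta_body (I : (pt -> R) -> Prop) (k : nat) : pt -> Prop :=
  fun p => forall l, polyfun_deg 1 l -> k_sos_mod I k l -> 0 <= l p.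

Definition conv (A : pt -> Prop) : pt -> Prop :=
  fun x => exists (m : nat) (ps : 'I_m -> pt) (w : 'I_m -> R),
    (forall i, A (ps i)) /\ (forall i, 0 <= w i) /\
    \sum_i w i = 1 /\ x = \sum_i w i *: ps i.

Definition aff (A : pt -> Prop) : pt -> Prop :=
  fun x => exists (m : nat) (ps : 'I_m -> pt) (w : 'I_m -> R),
    (forall i, A (ps i)) /\ \sum_i w i = 1 /\ x = \sum_i w i *: ps i.

Definition closure (A : pt -> Prop) : pt -> Prop :=
  fun x => forall e : R, 0 < e ->
    exists y, A y /\ forall i : 'I_n, `|x ord0 i - y ord0 i| < e.

Definition TH_exact (I : (pt -> R) -> Prop) (k : nat) : Prop :=
  forall p, theta_body I k p <-> closure (conv (real_zero_set I)) p.

Definition aff_indep (k : nat) (ps : 'I_k.+1 -> pt) : bool :=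
  row_free (\matrix_(i < k) (ps (lift ord0 i) - ps ord0)).

Definition has_affdim (A : pt -> Prop) (d : nat) : Prop :=
  (exists ps : 'I_d.+1 -> pt, (forall i, A (ps i)) /\ aff_indep ps) /\
  (forall ps : 'I_d.+2 -> pt, (forall i, A (ps i)) -> ~~ aff_indep ps).

Definition dotp (a x : pt) : R := \sum_i a ord0 i * x ord0 i.

Definition face (P F : pt -> Prop) : Prop :=
  exists (a : pt) (c : R), (forall x, P x -> c <= dotp a x) /\
    (forall x, F x <-> (P x /\ dotp a x = c)).

Definition facet (P F : pt -> Prop) : Prop :=
  face P F /\ exists d, has_affdim F d /\ has_affdim P d.+1.

End Defs.

(* Main.v *)
(** Homogenise points as [hat x = (1, x)], so that affine functions are column
    vectors acting on [hat x].

    If a facet inequality [0 <= G] takes two distinct positive values on [S], at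
    [s1] and [s2] say, then a combination of evaluations with large weight on the
    points of the facet, weight [1] at [s2] and a suitable negative weight at [s1]
    is nonnegative on squares of affine functions but negative on [G]; it is
    evaluation at a point of the first theta body outside [conv S].

    Conversely, a point of the affine hull outside [conv S] is separated from [S] by
    an affine function (Farkas), which can be tilted until it defines a facet; if it
    takes only the values [0] and [b > 0] on [S], it coincides there with the
    square of [G / sqrt b], so it is nonnegative on the theta body. *)

Require Import Defs.
From HB Require Import structures.
From mathcomp Require Import all_boot all_order all_algebra.
From mathcomp Require Import ring lra.
From Stdlib Require Import FunctionalExtensionality.
Import Order.TTheory GRing.Theory Num.Theory.
Local Open Scope ring_scope.

Set Implicit Arguments.
Unset Strict Implicit.
Unset Printing Implicit Defensive.

(** * Farkas' lemma for the cone spanned by the rows of a matrix *)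

Section Farkas.
Variables (R : realFieldType) (N : nat).

(** Induction on the number of generators: when the separator [c] found for the tail [A'] is
    negative on the new row [a], everything is projected along [a] onto the kernel of [c]. *)
Lemma farkas m (A : 'M[R]_(m, N)) (b : 'rV[R]_N) :
  (exists2 w : 'rV[R]_m, (forall i, 0 <= w 0 i) & b = w *m A) \/
  (exists2 c : 'cV[R]_N, (forall i, 0 <= (A *m c) i 0) & (b *m c) 0 0 < 0).
Proof.
elim: m A b => [|m IHm] A b.
  have [->|/rV0Pn[j bj]] := eqVneq b 0.
    by left; exists 0 => [[] //|]; rewrite mul0mx.
  right; exists (- b 0 j *: delta_mx j 0) => [[] //|].
  rewrite -scalemxAr -colE !mxE mulNr oppr_lt0 -expr2.
  by rewrite exprn_even_gt0.
move: A; change m.+1 with (1 + m)%N => A.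
pose a := usubmx A; pose A' := dsubmx A.
have Acol : A = col_mx a A' by rewrite vsubmxK.
case: (IHm A' b) => [[w w0 ->]|[c c0 bc]].
  left; exists (row_mx 0 w) => [i|]; last first.
    by rewrite Acol mul_row_col mul0mx add0r.
  by rewrite mxE; case: splitP => j _; rewrite // mxE.
pose al := (a *m c) 0 0.
have acE : a *m c = al%:M by rewrite [LHS]mx11_scalar.
have [al0|al0] := leP 0 al.
  right; exists c => // i; rewrite Acol mul_col_mx mxE.
  by case: splitP => j _ //; rewrite ord1.
have [] := IHm (A' - (al^-1 *: (A' *m c)) *m a) (b - (al^-1 *: (b *m c)) *m a).
- case=> w w0 Eb; left.
  have w'0 : 0 <= al^-1 * ((b *m c) 0 0 - (w *m (A' *m c)) 0 0).
    rewrite mulr_le0 ?invr_le0 ?(ltW al0) // subr_le0 (le_trans (ltW bc)) //.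
    by rewrite mxE sumr_ge0 // => i _; rewrite mulr_ge0.
  exists (row_mx (al^-1 * ((b *m c) 0 0 - (w *m (A' *m c)) 0 0))%:M w).
    move=> i; rewrite mxE; case: splitP => j _ //.
    by rewrite ord1 mxE.
  rewrite Acol mul_row_col mul_scalar_mx.
  move/eqP: Eb; rewrite subr_eq => /eqP Eb; rewrite [LHS]Eb.
  have rank1 (u : 'M[R]_1) : (al^-1 *: u) *m a = (al^-1 * u 0 0) *: a.
    by rewrite {1}[u]mx11_scalar scale_scalar_mx mul_scalar_mx.
  rewrite mulmxBr [w *m (_ *m a)]mulmxA -scalemxAr !rank1 mulrBr scalerBl.
  by rewrite [RHS]addrC addrAC addrA.
- case=> c' c'0 bc'; right.
  (* This is [c'] composed with the projection: it vanishes on [a] and takes on each row the value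
     of [c'] on the projected row. *)
  have E k (B : 'M[R]_(k, N)) : B *m (c' - c *m (al^-1 *: (a *m c'))) =
      (B - (al^-1 *: (B *m c)) *m a) *m c'.
    by rewrite mulmxBr mulmxBl -!scalemxAr -!scalemxAl !mulmxA.
  exists (c' - c *m (al^-1 *: (a *m c'))); last by rewrite E.
  move=> i; rewrite Acol mul_col_mx mxE; case: splitP => j _; last by rewrite E.
  rewrite mulmxBr mulmxA acE mul_scalar_mx scalerA divff ?lt_eqF //.
  by rewrite scale1r subrr mxE.
Qed.

End Farkas.

(** * Affine geometry of finite sets as linear algebra on homogenised points *)

Section Homogenisation.
Variables (R : rcfType) (n : nat).
Implicit Types (x y p s v : 'rV[R]_n) (S Z : seq 'rV[R]_n).
Implicit Types (G H : 'cV[R]_(1 + n)) (A : 'rV[R]_n -> Prop).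

Definition hat x : 'rV[R]_(1 + n) := row_mx 1%:M x.

Definition hats Z : 'M[R]_(size Z, 1 + n) := \matrix_(i < size Z) hat Z`_i.

Definition ev G x : R := (hat x *m G) 0 0.

Lemma ev_scalar G x : hat x *m G = (ev G x)%:M.
Proof. exact: mx11_scalar. Qed.

Lemma evD G H x : ev (G + H) x = ev G x + ev H x.
Proof. by rewrite /ev mulmxDr mxE. Qed.

Lemma evZ a G x : ev (a *: G) x = a * ev G x.
Proof. by rewrite /ev -scalemxAr mxE. Qed.

Lemma ev_col c (a : 'rV[R]_n) x : ev (col_mx c%:M a^T) x = c + dotp a x.
Proof.
rewrite /ev mul_row_col mul1mx mxE mxE eqxx mulr1n; congr (_ + _).
by rewrite mxE; apply: eq_bigr => i _; rewrite !mxE mulrC.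
Qed.

Lemma cV_split G : G = col_mx (G 0 0)%:M ((dsubmx G)^T)^T.
Proof.
rewrite trmxK -[LHS]vsubmxK [usubmx G]mx11_scalar; congr (col_mx _%:M _).
by rewrite mxE; congr (G _ _); apply: val_inj.
Qed.

Lemma ev_dotp G x : ev G x = G 0 0 + dotp (dsubmx G)^T x.
Proof. by rewrite {1}[G]cV_split ev_col. Qed.

Lemma hat00 x : hat x 0 0 = 1.
Proof.
by rewrite mxE; case: splitP => [j _|j]; rewrite ?ord1 ?mxE ?eqxx.
Qed.

Lemma hat_rsubmx (q : 'rV[R]_(1 + n)) : q 0 0 = 1 -> hat (rsubmx q) = q.
Proof.
move=> q1; rewrite -[RHS]hsubmxK [lsubmx q]mx11_scalar; congr (row_mx _%:M _).
by rewrite mxE -q1; congr (q _ _); apply: val_inj.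
Qed.

Lemma hat_inj : injective hat.
Proof. by move=> x y /eq_row_mx[]. Qed.

Lemma sum_hat m (w : 'I_m -> R) (ps : 'I_m -> 'rV[R]_n) :
  \sum_i w i *: hat (ps i) = row_mx (\sum_i w i)%:M (\sum_i w i *: ps i).
Proof.
rewrite -[LHS]hsubmxK !linear_sum /=; congr row_mx.
  rewrite raddf_sum; apply: eq_bigr => i _.
  by rewrite linearZ /= row_mxKl scale_scalar_mx mulr1.
by apply: eq_bigr => i _; rewrite linearZ /= row_mxKr.
Qed.

Lemma hat_sum m (w : 'I_m -> R) (ps : 'I_m -> 'rV[R]_n) :
  \sum_i w i = 1 -> hat (\sum_i w i *: ps i) = \sum_i w i *: hat (ps i).
Proof. by move=> w1; rewrite sum_hat w1. Qed.

Lemma hat_sumP m (w : 'I_m -> R) (ps : 'I_m -> 'rV[R]_n) x :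
  hat x = \sum_i w i *: hat (ps i) -> \sum_i w i = 1 /\ x = \sum_i w i *: ps i.
Proof.
rewrite sum_hat => /eq_row_mx[/matrixP/(_ 0 0) + ->].
by rewrite !mxE eqxx.
Qed.

Lemma mul_hats Z (D : 'rV[R]_(size Z)) :
  D *m hats Z = \sum_i D 0 i *: hat Z`_i.
Proof. by rewrite mulmx_sum_row; apply: eq_bigr => i _; rewrite rowK. Qed.

Lemma hats_mul Z G i : (hats Z *m G) i 0 = ev G Z`_i.
Proof.
rewrite /ev -[hat _](rowK (fun j : 'I_(size Z) => hat Z`_j) i) -row_mul.
by rewrite [RHS]mxE.
Qed.

Lemma hats_sub Z z : z \in Z -> (hat z <= hats Z)%MS.
Proof.
rewrite -index_mem => zZ.
have {1}-> : hat z = row (Ordinal zZ) (hats Z).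
  by rewrite rowK /= nth_index // -index_mem.
exact: row_sub.
Qed.

Lemma hats_subP Z m (W : 'M[R]_(m, 1 + n)) :
  (forall z, z \in Z -> (hat z <= W)%MS) -> (hats Z <= W)%MS.
Proof.
by move=> ZW; apply/row_subP => i; rewrite rowK; apply/ZW/mem_nth.
Qed.

Lemma hats_kermx Z G :
  (forall z, z \in Z -> ev G z = 0) -> (hats Z <= kermx G)%MS.
Proof.
move=> Z0; apply: hats_subP => z /Z0 e.
by apply/sub_kermxP; rewrite ev_scalar e raddf0.
Qed.

Lemma ev_sub0 Z G x : (forall z, z \in Z -> ev G z = 0) ->
  (hat x <= hats Z)%MS -> ev G x = 0.
Proof.
move=> /hats_kermx ZG /submx_trans/(_ ZG)/sub_kermxP.
by rewrite /ev => ->; rewrite mxE.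
Qed.

(** The leading coordinate 1 of [hat] forces weights to sum to 1, so affine hulls become row spaces.
    The list [Z] generates a possibly infinite [A], such as a face. *)
Lemma affP A Z x : (forall z, z \in Z -> A z) ->
    (forall y, A y -> (hat y <= hats Z)%MS) ->
  aff A x <-> (hat x <= hats Z)%MS.
Proof.
move=> ZA AZ; split=> [[m [ps [w [psA [w1 ->]]]]]|/submxP[D]].
  rewrite hat_sum //; apply: summx_sub => i _; exact/scalemx_sub/AZ.
rewrite mul_hats => /hat_sumP[w1 ->].
by exists (size Z), (fun i => Z`_i), (D 0); split=> // i; apply/ZA/mem_nth.
Qed.

Lemma row_freeP m q (B : 'M[R]_(m, q)) :
  reflect (forall u : 'rV_m, u *m B = 0 -> u = 0) (row_free B).
Proof.
apply: (iffP idP) => [fB u uB|]; last exact: inj_row_free.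
by apply: (row_free_inj fB); rewrite /= uB mul0mx.
Qed.

(** The weights of a linear relation among homogenised points sum to 0, so the weight of the base
    point is determined by the others and the relation becomes one among differences. *)
Lemma aff_indepE k (ps : 'I_k.+1 -> 'rV[R]_n) :
  aff_indep ps = row_free (\matrix_i hat (ps i)).
Proof.
have comb (u : 'rV[R]_k.+1) : u *m (\matrix_i hat (ps i)) =
    row_mx (\sum_i u 0 i)%:M (\sum_i u 0 i *: ps i).
  by rewrite -sum_hat mulmx_sum_row; apply: eq_bigr => i _; rewrite rowK.
have diff (u : 'rV[R]_k) :
    u *m (\matrix_i (ps (lift ord0 i) - ps ord0)) =
    \sum_i u 0 i *: ps (lift ord0 i) - (\sum_i u 0 i) *: ps ord0.
  rewrite mulmx_sum_row scaler_suml -sumrB; apply: eq_bigr => i _.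
  by rewrite rowK scalerBr.
apply/row_freeP/row_freeP => fr u.
  rewrite comb -row_mx0 => /eq_row_mx[/matrixP/(_ 0 0)].
  rewrite !mxE eqxx mulr1n !big_ord_recl => s0 c0.
  have u0E : u 0 ord0 = - \sum_(i < k) u 0 (lift ord0 i).
    by apply/eqP; rewrite -addr_eq0 s0.
  have u'0 : \row_i u 0 (lift ord0 i) = 0 :> 'rV_k.
    apply: fr; rewrite diff; under eq_bigr do rewrite mxE.
    under [X in _ - X *: _]eq_bigr do rewrite mxE.
    by rewrite -scaleNr -u0E addrC.
  have uS i : u 0 (lift ord0 i) = 0 by move/rowP/(_ i): u'0; rewrite !mxE.
  apply/rowP => i; rewrite mxE; case: (unliftP ord0 i) => [j|] -> //.
  by rewrite u0E big1 ?oppr0.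
rewrite diff => d0.
pose u' : 'rV[R]_k.+1 := \row_i oapp (u 0) (- \sum_i u 0 i) (unlift ord0 i).
have u'0 : u' 0 ord0 = - \sum_i u 0 i by rewrite mxE unlift_none.
have u'S i : u' 0 (lift ord0 i) = u 0 i by rewrite mxE liftK.
suff /rowP u'z : u' = 0 by apply/rowP => i; rewrite -u'S u'z !mxE.
apply: fr; rewrite comb !big_ord_recl u'0.
have -> : \sum_i u' 0 (lift ord0 i) = \sum_i u 0 i.
  by apply: eq_bigr => i _; rewrite u'S.
have -> : \sum_i u' 0 (lift ord0 i) *: ps (lift ord0 i) =
    \sum_i u 0 i *: ps (lift ord0 i).
  by apply: eq_bigr => i _; rewrite u'S.
by rewrite addNr raddf0 scaleNr addrC d0 row_mx0.
Qed.

Lemma aff_indep_rank Z k (ps : 'I_k.+1 -> 'rV[R]_n) :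
  (forall i, (hat (ps i) <= hats Z)%MS) -> aff_indep ps -> (k < \rank (hats Z))%N.
Proof.
rewrite aff_indepE => psZ /eqP <-; apply: mxrankS.
by apply/row_subP => i; rewrite rowK.
Qed.

Lemma exists_aff_indep Z k : (k < \rank (hats Z))%N ->
  exists2 ps : 'I_k.+1 -> 'rV[R]_n, forall i, ps i \in Z & aff_indep ps.
Proof.
move=> kr; pose f i := maxrankfun (hats Z) (widen_ord kr i).
exists (fun i => Z`_(f i)) => [i|]; first exact: mem_nth.
rewrite aff_indepE; apply/row_freeP => u u0.
pose D : 'M[R]_(k.+1, _) := rowsub (widen_ord kr) 1%:M.
have uD : u *m D = 0.
  apply: (row_free_inj (maxrowsub_free (hats Z))); rewrite /= mul0mx -mulmxA.
  rewrite mul_rowsub_mx mul1mx -{}[RHS]u0; congr (_ *m _).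
  by apply/matrixP=> i j; rewrite !mxE.
apply/rowP => i; move/rowP/(_ (widen_ord kr i)): uD; rewrite !mxE.
rewrite (bigD1 i) //= !mxE eqxx mulr1 big1 ?addr0 // => j ji.
by rewrite !mxE -val_eqE /= val_eqE (negPf ji) mulr0.
Qed.

Lemma has_affdimP A Z d : (forall z, z \in Z -> A z) ->
    (forall y, A y -> (hat y <= hats Z)%MS) ->
  has_affdim A d <-> \rank (hats Z) = d.+1.
Proof.
move=> ZA AZ; split=> [[[ps [psA ips]] no]|rZ]; last split.
- apply/eqP; rewrite eqn_leq (aff_indep_rank _ ips) ?andbT => [|i]; last exact: AZ.
  rewrite leqNgt; apply/negP => /exists_aff_indep[qs qsZ].
  by apply/negP/no => i; apply: ZA.
- have [|ps psZ ips] := @exists_aff_indep Z d; first by rewrite rZ.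
  by exists ps; split=> // i; apply: ZA.
- move=> ps psA; apply/negP => /aff_indep_rank-/(_ Z).
  by rewrite rZ ltnn => /(_ (fun i => AZ _ (psA i))).
Qed.

Definition zeros G S := [seq s <- S | ev G s == 0].

Lemma mem_conv S s : s \in S -> conv (fun x => x \in S) s.
Proof.
move=> sS; exists 1%N, (fun=> s), (fun=> 1).
by rewrite !big_ord1 scale1r.
Qed.

Lemma conv_sub S x : conv (fun x => x \in S) x -> (hat x <= hats S)%MS.
Proof.
move=> [m [ps [w [psS [_ [w1 ->]]]]]]; rewrite hat_sum //.
by apply: summx_sub => i _; apply/scalemx_sub/hats_sub.
Qed.

Lemma ev_sum m (w : 'I_m -> R) (ps : 'I_m -> 'rV[R]_n) G :
  \sum_i w i = 1 -> ev G (\sum_i w i *: ps i) = \sum_i w i * ev G (ps i).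
Proof.
move=> w1; rewrite /ev hat_sum // mulmx_suml summxE.
by apply: eq_bigr => i _; rewrite -scalemxAl mxE.
Qed.

Lemma conv_ev_ge0 A G x : (forall s, A s -> 0 <= ev G s) ->
  conv A x -> 0 <= ev G x.
Proof.
move=> G0 [m [ps [w [psS [w0 [w1 ->]]]]]]; rewrite ev_sum //.
by apply: sumr_ge0 => i _; rewrite mulr_ge0 ?G0.
Qed.

(** A sum of nonnegative terms is zero only if each term is, so every point with positive weight is
    a zero of [G]. This replaces a face by a finite list. *)
Lemma conv_zeros_sub S G x : (forall s, s \in S -> 0 <= ev G s) ->
  conv (fun x => x \in S) x -> ev G x = 0 -> (hat x <= hats (zeros G S))%MS.
Proof.
move=> G0 [m [ps [w [psS [w0 [w1 ->]]]]]]; rewrite ev_sum // => /eqP.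
rewrite psumr_eq0 => [/allP e0|i _]; last by rewrite mulr_ge0 ?G0.
rewrite hat_sum //; apply: summx_sub => i _.
have := e0 i (mem_index_enum _); rewrite mulf_eq0 => /orP[/eqP->|e].
  by rewrite scale0r sub0mx.
by apply/scalemx_sub/hats_sub; rewrite mem_filter e psS.
Qed.

Lemma zeros_sub G S : (hats (zeros G S) <= hats S)%MS.
Proof. by apply: hats_subP => z; rewrite mem_filter => /andP[_ /hats_sub]. Qed.

Lemma ev_zeros G S z : z \in zeros G S -> ev G z = 0.
Proof. by rewrite mem_filter => /andP[/eqP]. Qed.

(** Dimension count: the kernel of [G] meets the span of [S] in a proper subspace containing the
    span of the zeros, which has codimension at most one; hence the two coincide. *)
Lemma ker_zeros_sub S G (q : 'rV[R]_(1 + n)) :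
    (\rank (hats S) <= (\rank (hats (zeros G S))).+1)%N ->
    (exists2 s, s \in S & ev G s != 0) ->
  (q <= hats S)%MS -> q *m G = 0 -> (q <= hats (zeros G S))%MS.
Proof.
move=> rk [s sS Gs] qS /sub_kermxP qG.
set K := (hats S :&: kermx G)%MS.
have qK : (q <= K)%MS by rewrite sub_capmx qS qG.
have ZK : (hats (zeros G S) <= K)%MS.
  by rewrite sub_capmx zeros_sub hats_kermx // => z /ev_zeros.
have rK : (\rank K < \rank (hats S))%N.
  rewrite ltn_neqAle mxrankS ?capmxSl // andbT.
  apply/negP => /eqP rE; move: (mxrank_leqif_sup (capmxSl (hats S) (kermx G))).
  rewrite -/K => -[_]; rewrite rE eqxx => /esym SK.
  have := submx_trans (hats_sub sS) (submx_trans SK (capmxSr _ _)).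
  by move=> /sub_kermxP/matrixP/(_ 0 0); rewrite -/(ev G s) mxE; apply/eqP.
apply: submx_trans qK _.
rewrite -(mxrank_leqif_sup ZK) eqn_leq mxrankS //=.
by rewrite -ltnS (leq_trans rK rk).
Qed.

End Homogenisation.

(** * Separation from the convex hull, and facets via linear functionals *)

Section Separation.
Variables (R : rcfType) (n : nat).
Implicit Types (x y p s v : 'rV[R]_n) (S Z : seq 'rV[R]_n).
Implicit Types (G H : 'cV[R]_(1 + n)) (A : 'rV[R]_n -> Prop).

Lemma separate_span m (W : 'M[R]_(m, 1 + n)) s : ~~ (hat s <= W)%MS ->
  exists2 G, W *m G = 0 & ev G s < 0.
Proof.
rewrite submxE => /rV0Pn[j sj].
pose G := col j (cokermx W).
have WG : W *m G = 0 by rewrite /G colE mulmxA mulmx_coker mul0mx.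
have Gs : ev G s != 0 by rewrite /ev /G colE mulmxA -colE mxE.
have [Gs0|Gs0] := ltP (ev G s) 0; first by exists G.
exists (-1 *: G); first by rewrite -scalemxAr WG scaler0.
by rewrite evZ mulN1r oppr_lt0 lt_def Gs.
Qed.

(* Tilt [G] around its zeros on [S] and [p] until one more point of [S] is hit. *)
Lemma pivot S G p :
    (forall s, s \in S -> 0 <= ev G s) -> ev G p < 0 ->
    ((\rank (hats (zeros G S))).+1 < \rank (hats S))%N ->
  exists G', [/\ forall s, s \in S -> 0 <= ev G' s, ev G' p < 0 &
    (\rank (hats (zeros G S)) < \rank (hats (zeros G' S)))%N].
Proof.
move=> G0 Gp rk; pose W := col_mx (hats (zeros G S)) (hat p).
(* Codimension at least two leaves a point of [S] outside the span of the zeros and [p], so some [M]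
   vanishes on these and is negative at that point. *)
have : ~~ (hats S <= W)%MS.
  apply/negP => /mxrankS; apply/negP; rewrite -ltnNge.
  apply: leq_ltn_trans rk; rewrite -addsmxE.
  apply: leq_trans (mxrank_adds_leqif _ _) _.
  by rewrite -[X in (_ <= X)%N]addn1 leq_add2l rank_leq_row.
case/row_subPn => i0; rewrite rowK => /separate_span[M].
rewrite mul_col_mx -[0]col_mx0 => /eq_col_mx[MZ Mp] Mi0.
have {}Mp : ev M p = 0 by rewrite /ev Mp mxE.
have {}MZ z : z \in zeros G S -> ev M z = 0.
  move=> /hats_sub/submxP[D E]; by rewrite /ev E -mulmxA MZ mulmx0 mxE.
(* Ratio test: [F i] is the step at which the value at the [i]-th point reaches 0. The least one
   creates a new zero and keeps all values nonnegative. *)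
pose F (i : 'I_(size S)) := ev G S`_i / - ev M S`_i.
have [i Mi Fmin] := @arg_minP _ _ _ i0 (fun i => ev M S`_i < 0) F Mi0.
have iS : S`_i \in S by apply: mem_nth.
have Fi0 : 0 <= F i by rewrite divr_ge0 ?G0 // oppr_ge0 ltW.
exists (G + F i *: M); split.
- move=> s sS; rewrite evD evZ.
  have [Ms|Ms] := ltP (ev M s) 0; last by apply: addr_ge0 (G0 _ sS) (mulr_ge0 Fi0 Ms).
  have sS' : (index s S < size S)%N by rewrite index_mem.
  have := Fmin (Ordinal sS'); rewrite /= /F nth_index // => /(_ Ms).
  by rewrite -/(F i) ler_pdivlMr ?oppr_gt0 // mulrN -subr_ge0 opprK.
- by rewrite evD evZ Mp mulr0 addr0.
- have ZZ : (hats (zeros G S) <= hats (zeros (G + F i *: M) S))%MS.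
    apply: hats_subP => z zZ; apply: hats_sub; rewrite mem_filter evD evZ.
    rewrite MZ // (ev_zeros zZ) mulr0 addr0 eqxx /=.
    by move: zZ; rewrite mem_filter => /andP[].
  rewrite ltn_neqAle mxrankS // andbT (mxrank_leqif_sup ZZ).
  apply/negP => Z'Z.
  have /hats_sub iZ' : S`_i \in zeros (G + F i *: M) S.
    rewrite mem_filter iS andbT evD evZ /F invrN mulrN mulNr divfK ?subrr //.
    by rewrite lt_eqF.
  have := ev_sub0 MZ (submx_trans iZ' Z'Z).
  by apply/eqP; rewrite lt_eqF.
Qed.

Lemma zeros_rank_lt S G p : (hat p <= hats S)%MS -> ev G p < 0 ->
  (\rank (hats (zeros G S)) < \rank (hats S))%N.
Proof.
move=> pS Gp; rewrite ltn_neqAle mxrankS ?zeros_sub // andbT.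
rewrite (mxrank_leqif_sup (zeros_sub G S)); apply/negP => SZ.
have := ev_sub0 (@ev_zeros _ _ G S) (submx_trans pS SZ).
by apply/eqP; rewrite lt_eqF.
Qed.

(** Each pivot raises the rank of the zeros, so induction on their codimension in the span of [S]
    stops at codimension one. *)
Lemma separating_facet S G p : (hat p <= hats S)%MS ->
    (forall s, s \in S -> 0 <= ev G s) -> ev G p < 0 ->
  exists G', [/\ forall s, s \in S -> 0 <= ev G' s, ev G' p < 0 &
    \rank (hats S) = (\rank (hats (zeros G' S))).+1].
Proof.
move=> pS; have [k] := ubnP (\rank (hats S) - \rank (hats (zeros G S))).
elim: k G => // k IHk G; rewrite ltnS => lek G0 Gp.
have := zeros_rank_lt pS Gp; rewrite leq_eqVlt => /orP[/eqP e|lt].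
  by exists G.
have [G' [G'0 G'p lt']] := pivot G0 Gp lt.
apply: (IHk G') => //; apply: leq_trans lek.
by apply: ltn_sub2l => //; apply: ltn_trans lt.
Qed.

(** Farkas' lemma on homogenised points: the leading coordinate makes a conic combination equal to
    [hat p] convex. *)
Lemma conv_or_separated S p : conv (fun x => x \in S) p \/
  exists2 G, (forall s, s \in S -> 0 <= ev G s) & ev G p < 0.
Proof.
have [[w w0]|[G G0 Gp]] := farkas (hats S) (hat p).
  rewrite mul_hats => /hat_sumP[w1 ->]; left.
  by exists (size S), (fun i => S`_i), (w 0); split=> // i; apply: mem_nth.
right; exists G => // s sS.
have sS' : (index s S < size S)%N by rewrite index_mem.
by have := G0 (Ordinal sS'); rewrite hats_mul /= nth_index.
Qed.

Lemma face_zeros S G F : (forall s, s \in S -> 0 <= ev G s) ->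
    (forall x, F x <-> conv (fun x => x \in S) x /\ ev G x = 0) ->
  (forall z, z \in zeros G S -> F z) /\
  (forall x, F x -> (hat x <= hats (zeros G S))%MS).
Proof.
move=> G0 FE; split=> [z|x /FE[xS Gx]]; last exact: conv_zeros_sub.
by rewrite mem_filter => /andP[/eqP Gz zS]; apply/FE; split=> //; apply: mem_conv.
Qed.

(** Reduces facets to ranks of finite lists. The zeros are required to be nonempty because, for a
    one-point [S], the rank equation also holds for the empty face, which has no affine
    dimension. *)
Lemma facetP S F : facet (conv (fun x => x \in S)) F <->
  exists G, [/\ forall s, s \in S -> 0 <= ev G s,
    forall x, F x <-> conv (fun x => x \in S) x /\ ev G x = 0,
    zeros G S != [::] & \rank (hats S) = (\rank (hats (zeros G S))).+1].
Proof.
split=> [[[a [c [ac FE]]] [d [dF dS]]]|[G [G0 FE Z0 rk]]].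
  pose G : 'cV[R]_(1 + n) := col_mx (- c)%:M a^T.
  have GE x : ev G x = dotp a x - c by rewrite ev_col addrC.
  have G0 s : s \in S -> 0 <= ev G s by move=> /mem_conv/ac; rewrite GE subr_ge0.
  have FG x : F x <-> conv (fun x => x \in S) x /\ ev G x = 0.
    rewrite FE GE; split=> -[xS /eqP e]; split=> //; apply/eqP.
      by rewrite subr_eq0.
    by rewrite -subr_eq0.
  have [ZF FZ] := face_zeros G0 FG.
  move/(has_affdimP d ZF FZ): dF => rZ.
  move/(has_affdimP d.+1 (@mem_conv _ _ S) (@conv_sub _ _ S)): dS => rS.
  exists G; split=> //; last by rewrite rS rZ.
  apply/eqP => Z0; have := rank_leq_row (hats (zeros G S)).
  by rewrite rZ Z0.
have [ZF FZ] := face_zeros G0 FE; split.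
  exists (dsubmx G)^T, (- G 0 0); split=> x.
    by move=> /(conv_ev_ge0 G0); rewrite ev_dotp -lerBlDl sub0r.
  rewrite FE ev_dotp; split=> -[xS /eqP e]; split=> //; apply/eqP; move: e;
  by rewrite addrC addr_eq0.
have rZ : (0 < \rank (hats (zeros G S)))%N.
  case: (zeros G S) Z0 => // z Z _; rewrite lt0n mxrank_eq0; apply/eqP => e.
  have := hats_sub (mem_head z Z); rewrite e => /submx0null/rowP/(_ 0).
  by rewrite hat00 mxE => /eqP; rewrite oner_eq0.
exists (\rank (hats (zeros G S))).-1; rewrite prednK //; split.
  by apply/(has_affdimP _ ZF FZ); rewrite prednK.
exact/(has_affdimP _ (@mem_conv _ _ S) (@conv_sub _ _ S)).
Qed.

End Separation.

(** * Polynomial functions, sums of squares and the first theta body *)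

Section PolynomialFunctions.
Variables (R : rcfType) (n : nat).
Implicit Types (x : 'rV[R]_n) (f g : 'rV[R]_n -> R) (S : seq 'rV[R]_n).
Implicit Types (G H : 'cV[R]_(1 + n)).

Lemma polyfun_scale k c f : polyfun_deg k f -> polyfun_deg k (fun x => c * f x).
Proof. exact: (pf_mul (pf_const _ c)). Qed.

Lemma polyfun_opp k f : polyfun_deg k f -> polyfun_deg k (fun x => - f x).
Proof.
move=> /(polyfun_scale (-1)); congr polyfun_deg.
by apply: functional_extensionality => x; rewrite mulN1r.
Qed.

Lemma polyfun_sum k (I : Type) (r : seq I) (F : I -> 'rV[R]_n -> R) :
  (forall i, polyfun_deg k (F i)) -> polyfun_deg k (fun x => \sum_(i <- r) F i x).
Proof.
move=> kF; elim: r => [|i r IHr].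
  have -> : (fun x => \sum_(i <- [::]) F i x) = fun=> 0.
    by apply: functional_extensionality => x; rewrite big_nil.
  exact: pf_weaken (leq0n k) (pf_const _ 0).
have -> : (fun x => \sum_(j <- i :: r) F j x) =
    fun x => F i x + \sum_(j <- r) F j x.
  by apply: functional_extensionality => x; rewrite big_cons.
exact: pf_add.
Qed.

Lemma polyfun_sqr k f : polyfun_deg k f -> polyfun_deg (k + k) (fun x => f x ^+ 2).
Proof. by move=> kf; apply: pf_mul. Qed.

Lemma polyfun_ev G : polyfun_deg 1 (ev G).
Proof.
have -> : ev G = fun x => G 0 0 + \sum_i (dsubmx G)^T 0 i * x 0 i.
  by apply: functional_extensionality => x; rewrite ev_dotp.
apply: pf_add; first exact: pf_weaken (pf_const _ _).
by apply: polyfun_sum => i; apply/polyfun_scale/pf_coord.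
Qed.

Lemma ev_const c x : ev (col_mx c%:M 0) x = c.
Proof. by rewrite /ev mul_row_col mul1mx mulmx0 addr0 mxE eqxx. Qed.

Lemma polyfun_deg1P f : polyfun_deg 1 f -> exists G, f =1 ev G.
Proof.
(* Degree 0 is tracked too: in a product of total degree at most 1, one factor has degree 0 and must
   be known to be constant. *)
suff : forall k, polyfun_deg k f ->
    (k = 0%N -> exists c, f =1 fun=> c) /\ ((k <= 1)%N -> exists G, f =1 ev G).
  by move=> + f1 => /(_ 1%N f1)[_ /(_ isT)].
move=> k; elim => {k f} [c|i|k f g _ [f0 f1] _ [g0 g1]
                    |k l f g _ [f0 f1] _ [g0 g1]|k l f kl _ [f0 f1]].
- split=> _; first by exists c.
  by exists (col_mx c%:M 0) => x; rewrite ev_const.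
- split=> // _; exists (col_mx 0%:M (delta_mx 0 i)^T) => x.
  rewrite ev_col add0r /dotp (bigD1 i) //= mxE !eqxx mul1r big1 ?addr0 //.
  by move=> j /negPf ji; rewrite mxE ji andbF mul0r.
- split=> [k0|k1].
    have [c fc] := f0 k0; have [e ge] := g0 k0.
    by exists (c + e) => x; rewrite fc ge.
  have [G fG] := f1 k1; have [H gH] := g1 k1.
  by exists (G + H) => x; rewrite evD fG gH.
- split=> [/eqP|kl1].
    rewrite addn_eq0 => /andP[/eqP k0 /eqP l0].
    have [c fc] := f0 k0; have [e ge] := g0 l0.
    by exists (c * e) => x; rewrite fc ge.
  have k1 := leq_trans (leq_addr l k) kl1.
  have l1 := leq_trans (leq_addl k l) kl1.
  case: k {f1} f0 {g1} kl1 k1 (f1 k1) (g1 l1) => [|k] f0 kl1 k1 [G fG] [H gH].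
    have [c fc] := f0 erefl.
    by exists (c *: H) => x; rewrite evZ fc gH.
  have [|c gc] := g0; first by case: l kl1 {g0 l1} => // l; rewrite addnS.
  by exists (c *: G) => x; rewrite evZ fG gc mulrC.
- split=> [l0|l1]; first by apply: f0; apply/eqP; rewrite -leqn0 -l0.
  exact/f1/leq_trans/l1.
Qed.

(** Finite sets are real algebraic: the product of the squared distances to the points of [S]
    vanishes exactly on [S]. *)
Lemma vanishing_zero_set S x :
  real_zero_set (vanishing_ideal (fun y => y \in S)) x <-> x \in S.
Proof.
split=> [Vx|xS f [_ /(_ _ xS)] //].
pose d (s x : 'rV[R]_n) := \sum_i (x 0 i - s 0 i) ^+ 2 : R.
have d0 s y : (d s y == 0) = (y == s).
  rewrite psumr_eq0 => [|i _]; last exact: sqr_ge0.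
  apply/allP/eqP => [e|-> i _]; last by rewrite /= subrr expr0n eqxx.
  apply/rowP => i; have := e i (mem_index_enum _).
  by rewrite sqrf_eq0 subr_eq0 => /eqP.
have pd s : polyfun_deg 2 (d s).
  apply: polyfun_sum => i; apply: (@polyfun_sqr 1).
  apply: pf_add; [exact: pf_coord|exact: pf_weaken (pf_const _ _)].
suff [P [[k kP] PE]] : exists P, is_polyfun P /\ forall y, (P y == 0) = (y \in S).
  by rewrite -PE; apply/eqP/Vx; split; [exists k|move=> y; rewrite -PE => /eqP].
elim: S {Vx} => [|s S [P [[k kP] PE]]].
  exists (fun=> 1); split; first by exists 0%N; apply: pf_const.
  by move=> y; rewrite oner_eq0.
exists (fun y => d s y * P y); split; first by exists (2 + k)%N; apply: pf_mul.
by move=> y; rewrite mulf_eq0 d0 PE in_cons.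
Qed.

Lemma ev_sos_mod S G m (H : 'I_m -> 'cV[R]_(1 + n)) :
    (forall s, s \in S -> ev G s = \sum_i ev (H i) s ^+ 2) ->
  k_sos_mod (vanishing_ideal (fun x => x \in S)) 1 (ev G).
Proof.
move=> E; exists m, (fun i => ev (H i)); split; first by move=> i; apply: polyfun_ev.
split=> [|s sS]; last by rewrite E ?subrr.
exists 2; apply: pf_add; first exact: pf_weaken (polyfun_ev G).
by apply/polyfun_opp/polyfun_sum => i; apply/(@polyfun_sqr 1)/polyfun_ev.
Qed.

(** Polynomial functions of degree at most 1 are exactly the [ev G], and congruence modulo the ideal
    is equality on [S], so the theta body can be described by vectors alone. *)
Lemma theta_bodyP S p : theta_body (vanishing_ideal (fun x => x \in S)) 1 p <->
  forall G m (H : 'I_m -> 'cV[R]_(1 + n)),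
    (forall s, s \in S -> ev G s = \sum_i ev (H i) s ^+ 2) -> 0 <= ev G p.
Proof.
split=> [Tp G m H E|Tp l l1 [m [g [g1 [_ lE]]]]].
  exact: Tp (polyfun_ev G) (ev_sos_mod E).
have [G GE] := polyfun_deg1P l1.
have [H HE] : exists H : 'I_m -> 'cV[R]_(1 + n), forall i, g i =1 ev (H i).
  elim: m g g1 {lE} => [|m IHm] g g1; first by exists (fun=> 0) => -[].
  have [H HE] := IHm _ (fun i => g1 (lift ord0 i)).
  have [H0 H0E] := polyfun_deg1P (g1 ord0).
  exists (fun i => oapp H H0 (unlift ord0 i)) => i.
  by case: (unliftP ord0 i) => [j|] -> //= x; rewrite HE.
rewrite GE; apply: (Tp G m H) => s sS.
move/eqP: (lE s sS); rewrite subr_eq0 -GE => /eqP ->.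
by apply: eq_bigr => i _; rewrite HE.
Qed.

End PolynomialFunctions.

(** * Exactness of the first theta body and the two-level property *)

Section Exactness.
Variables (R : rcfType) (n : nat).
Implicit Types (x y p s v : 'rV[R]_n) (S Z : seq 'rV[R]_n).
Implicit Types (G H : 'cV[R]_(1 + n)) (A : 'rV[R]_n -> Prop).

(** An affine function is Lipschitz for the maximum norm, with constant the sum of the absolute
    values of its linear coefficients. *)
Lemma closure_ev_ge0 A G p : (forall x, A x -> 0 <= ev G x) ->
  Defs.closure A p -> 0 <= ev G p.
Proof.
move=> G0 Ap; rewrite leNgt; apply/negP => Gp.
pose a := (dsubmx G)^T.
(* Adding 1 to the Lipschitz constant makes [K] positive even for constant [G], and yields
   [ev G y <= - e]. *)
pose K := 1 + \sum_i `|a 0 i|.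
have K0 : 0 < K by rewrite ltr_pwDl ?ltr01 ?sumr_ge0.
pose e := - ev G p / K; have e0 : 0 < e by rewrite divr_gt0 ?oppr_gt0.
have [y [/G0 Gy yp]] := Ap e e0.
have : ev G y - ev G p <= \sum_i `|a 0 i| * e.
  rewrite !ev_dotp opprD addrACA subrr add0r /dotp -sumrB.
  apply: ler_sum => i _; rewrite -mulrBr (le_trans (ler_norm _)) // normrM.
  by rewrite ler_wpM2l // distrC ltW.
rewrite -mulr_suml; have -> : \sum_i `|a 0 i| = K - 1 by rewrite /K addrAC subrr add0r.
have -> : (K - 1) * e = - ev G p - e by rewrite /e; field; rewrite gt_eqF.
by lra.
Qed.

(** Cauchy-Schwarz with a non-optimal constant, from [(x + y)^2 <= 2 x^2 + 2 y^2] at each induction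
    step. *)
Lemma lin_comb_sqr_bound m (u : 'rV[R]_m) :
  exists2 K, 0 <= K & forall g : 'cV[R]_m,
    (u *m g) 0 0 ^+ 2 <= K * \sum_i g i 0 ^+ 2.
Proof.
suff [K K0 Kg] : exists2 K, 0 <= K & forall g : 'I_m -> R,
    (\sum_i u 0 i * g i) ^+ 2 <= K * \sum_i g i ^+ 2.
  by exists K => // g; rewrite mxE (Kg (fun i => g i 0)).
elim: m u => [|m IHm] u.
  by exists 0 => // g; rewrite !big_ord0 expr0n mulr0.
have [K K0 Kg] := IHm (\row_i u 0 (lift ord0 i)).
exists (2 * K + 2 * u 0 ord0 ^+ 2) => [|g].
  by have := sqr_ge0 (u 0 ord0); lra.
rewrite !big_ord_recl; have := Kg (fun i => g (lift ord0 i)).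
under eq_bigr do rewrite mxE.
set a := \sum_i _; set b := \sum_i _; set g0 := g ord0; set u0 := u 0 ord0 => le.
have b0 : 0 <= b by apply: sumr_ge0 => i _; apply: sqr_ge0.
have h1 : 0 <= (u0 * g0 - a) ^+ 2 by apply: sqr_ge0.
have h2 : 0 <= K * g0 ^+ 2 by rewrite mulr_ge0 ?sqr_ge0.
have h3 : 0 <= u0 ^+ 2 * b by rewrite mulr_ge0 ?sqr_ge0.
nra.
Qed.

(* With [r] the ratio of the two positive values, [al] must satisfy [r < al] to
   make the functional negative on [G], and [al < r ^+ 2] to absorb the square
   of the value at [s1]; [M] then controls the remaining terms. *)
Lemma exact_two_values S G s1 s2 :
    (forall p, theta_body (vanishing_ideal (fun x => x \in S)) 1 p -> 0 <= ev G p) ->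
    zeros G S != [::] -> \rank (hats S) = (\rank (hats (zeros G S))).+1 ->
    s1 \in S -> s2 \in S -> 0 < ev G s1 ->
  ~ ev G s1 < ev G s2.
Proof.
move=> TG Z0 rk s1S s2S b1 b12.
set Z := zeros G S in Z0 rk *.
pose r := ev G s2 / ev G s1.
have r1 : 1 < r by rewrite ltr_pdivlMr ?mul1r.
have rb : r * ev G s1 = ev G s2 by rewrite divfK ?gt_eqF.
(* [G] kills this vector by the choice of [r], so it is a combination of the zeros. For every [H],
   the defect [ev H s2 - r * ev H s1] is thus controlled by the values of [H] on [Z]. *)
have : (hat s2 - r *: hat s1 <= hats Z)%MS.
  apply: ker_zeros_sub; first by rewrite rk.
  - by exists s1 => //; rewrite gt_eqF.
  - by rewrite addmx_sub ?eqmx_opp ?scalemx_sub ?hats_sub.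
  - rewrite mulmxBl -scalemxAl !ev_scalar scale_scalar_mx rb.
    by rewrite subrr.
case/submxP => u uE; have [K K0 KB] := lin_comb_sqr_bound u.
(* The midpoint lies strictly between [r] and [r ^+ 2] because [1 < r]. *)
pose al := (r + r ^+ 2) / 2.
have al_gt : r < al by rewrite /al; nra.
have al_lt : 0 < r ^+ 2 - al by rewrite /al; nra.
pose M := r ^+ 2 * K / (r ^+ 2 - al) + al.
have M_gt : al <= M.
  rewrite /M lerDr; apply: divr_ge0 (ltW al_lt).
  exact: mulr_ge0 (sqr_ge0 _) K0.
(* The total weight of the functional [L] below, that is, its value on the constant 1; dividing by
   it makes [q] a homogenised point. *)
pose T := M * (size Z)%:R + 1 - al.
have T0 : 0 < T.
  have : 1 <= (size Z)%:R :> R by rewrite ler1n lt0n size_eq0.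
  by rewrite /T; nra.
pose q := T^-1 *: (M *: (const_mx 1 *m hats Z) + hat s2 - al *: hat s1).
pose L H := M * (\sum_(i < size Z) ev H Z`_i) + ev H s2 - al * ev H s1.
have qE H : (q *m H) 0 0 = T^-1 * L H.
  rewrite -scalemxAl mxE; congr (_ * _).
  rewrite !mulmxDl mulNmx -!scalemxAl -mulmxA !ev_scalar mxE /L; congr (_ + _).
    rewrite !mxE; congr (_ * _ + _).
    by apply: eq_bigr => i _; rewrite !mxE mul1r -hats_mul mxE.
  by rewrite !mxE eqxx mulr1n.
have q1 : q 0 0 = 1.
  have ev00 x : ev (delta_mx 0 0) x = 1 by rewrite /ev -colE mxE hat00.
  have -> : q 0 0 = (q *m (delta_mx 0 0 : 'cV_(1 + n))) 0 0 by rewrite -colE [RHS]mxE.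
  rewrite qE /L !ev00 (eq_bigr (fun=> 1)) => [|i _]; last exact: ev00.
  by rewrite sumr_const card_ord mulr1 mulVf ?gt_eqF.
have pE H : ev H (rsubmx q) = T^-1 * L H by rewrite /ev hat_rsubmx.
have sq H : 0 <= M * (\sum_(i < size Z) ev H Z`_i ^+ 2) + ev H s2 ^+ 2 -
    al * ev H s1 ^+ 2.
  have := KB (hats Z *m H); rewrite mulmxA -uE mulmxBl -scalemxAl !ev_scalar.
  rewrite scale_scalar_mx -raddfB /= mxE eqxx mulr1n.
  under eq_bigr do rewrite hats_mul.
  set Q := \sum_i _; set X := ev H s1; set Y := ev H s2 => le.
  have Q0 : 0 <= Q by apply: sumr_ge0 => i _; apply: sqr_ge0.
  pose h := Y - r * X; have YE : Y = r * X + h by rewrite /h; ring.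
  rewrite -/h in le; rewrite YE.
  pose de := r ^+ 2 - al; rewrite -/de in al_lt.
  have de0 : de != 0 by rewrite gt_eqF.
  (* Completing the square in [X]. The two summands of [M] supply the two multiples of [Q], and the
     last term is nonnegative because [K * Q] bounds [h ^+ 2]. *)
  have -> : M * Q + (r * X + h) ^+ 2 - al * X ^+ 2 =
      de * (X + r * h / de) ^+ 2 + h ^+ 2 + al * Q + r ^+ 2 / de * (K * Q - h ^+ 2).
    by rewrite /M /de; field.
  have al0 : 0 <= al by lra.
  apply: addr_ge0; first apply: addr_ge0; first apply: addr_ge0.
  - exact: mulr_ge0 (ltW al_lt) (sqr_ge0 _).
  - exact: sqr_ge0.
  - exact: mulr_ge0.
  - apply: mulr_ge0; last by rewrite subr_ge0.
    exact: divr_ge0 (sqr_ge0 _) (ltW al_lt).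
have : 0 <= ev G (rsubmx q).
  apply/TG/theta_bodyP => H m g HE; rewrite pE mulr_ge0 ?invr_ge0 ?(ltW T0) // /L.
  have ZS i : (i < size Z)%N -> Z`_i \in S.
    by move=> /(mem_nth 0); rewrite mem_filter => /andP[].
  rewrite (eq_bigr (fun i : 'I_(size Z) => \sum_(j < m) ev (g j) Z`_i ^+ 2)); last first.
    by move=> i _; rewrite HE ?ZS.
  rewrite !HE // exchange_big /= !mulr_sumr -big_split -sumrB /=.
  exact: sumr_ge0.
(* The points of [Z] contribute nothing, so the value is a positive multiple of
   [(r - al) * ev G s1], which is negative. *)
rewrite pE /L big1 => [|i _]; last by apply: (@ev_zeros _ _ G S); apply: mem_nth.
rewrite pmulr_rge0 ?invr_gt0 // mulr0 add0r -rb; nra.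
Qed.

Lemma sub_theta_body S p : Defs.closure (conv (fun x => x \in S)) p ->
  theta_body (vanishing_ideal (fun x => x \in S)) 1 p.
Proof.
move=> cp; apply/theta_bodyP => G m H GE; apply: closure_ev_ge0 cp => x.
by apply: conv_ev_ge0 => s /GE ->; apply: sumr_ge0 => i _; apply: sqr_ge0.
Qed.

(** An affine function vanishing on [S] is the empty sum of squares modulo the ideal, whatever its
    sign elsewhere, so it cannot be negative on the theta body. *)
Lemma theta_body_span S p : theta_body (vanishing_ideal (fun x => x \in S)) 1 p ->
  (hat p <= hats S)%MS.
Proof.
move=> /theta_bodyP Tp; apply/negP => /negP/separate_span[G SG].
apply/negP; rewrite -leNgt; apply: (Tp G 0%N (fun=> 0)) => s sS.
rewrite big_ord0; have /submxP[D E] := hats_sub sS.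
by rewrite /ev E -mulmxA SG mulmx0 mxE.
Qed.

Lemma eq_conv A B : (forall x, A x <-> B x) -> forall x, conv A x <-> conv B x.
Proof.
move=> AB x; split=> -[m [ps [w [psA h]]]]; exists m, ps, w; split=> // i;
exact/AB.
Qed.

(** The reverse inclusion always holds, and the real zero set of the ideal is [S]. *)
Lemma exactP S : TH_exact (vanishing_ideal (fun x => x \in S)) 1 <->
  forall p, theta_body (vanishing_ideal (fun x => x \in S)) 1 p ->
    Defs.closure (conv (fun x => x \in S)) p.
Proof.
have VE := eq_conv (vanishing_zero_set S).
split=> [ex p /ex cp e /cp[y [/VE yA ye]]|ex p]; first by exists y.
split=> [/ex cp e /cp[y [/VE yA ye]]|cp]; first by exists y.
by apply: sub_theta_body => e /cp[y [/VE yA ye]]; exists y.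
Qed.

Lemma subset_closure A x : A x -> Defs.closure A x.
Proof. by move=> Ax e e0; exists x; split=> // i; rewrite subrr normr0. Qed.

(** The parallel hyperplane is encoded as the translate of [aff F] by [v]; the first condition keeps
    it inside the affine hull of [S]. *)
Definition two_level S := forall F, facet (conv (fun x => x \in S)) F ->
  exists v,
    (forall x, aff F x -> aff (fun y => y \in S) (x + v)) /\
    (forall s, s \in S -> F s \/ exists x, aff F x /\ s = x + v).

Lemma hatDB x y z : hat (x + (y - z)) = hat x + (hat y - hat z).
Proof. by rewrite /hat opp_row_mx !add_row_mx subrr addr0. Qed.

Lemma exact_two_level S :
  TH_exact (vanishing_ideal (fun x => x \in S)) 1 -> two_level S.
Proof.
move=> /exactP ex F /facetP[G [G0 FE Z0 rk]].
have TG p : theta_body (vanishing_ideal (fun x => x \in S)) 1 p -> 0 <= ev G p.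
  by move=> /ex; apply: closure_ev_ge0 => x; apply: conv_ev_ge0.
have [ZF FZ] := face_zeros G0 FE.
have affF x : aff F x <-> (hat x <= hats (zeros G S))%MS by apply: affP.
have [f fZ] : exists f, f \in zeros G S.
  by case: (zeros G S) Z0 => // f Z _; exists f; rewrite mem_head.
have [s1 s1S Gs1] : exists2 s, s \in S & ev G s != 0.
  apply/hasP; apply: contraT; rewrite -all_predC => /all_filterP.
  rewrite -[LHS]/(filter _ _); under eq_filter do rewrite /= negbK.
  by rewrite -/(zeros G S) => ZS; move: rk; rewrite ZS => /n_Sn.
have gt0 s : s \in S -> ev G s != 0 -> 0 < ev G s.
  by move=> /G0 ? ?; rewrite lt_def; apply/andP.
have fS : f \in S by move: fZ; rewrite mem_filter => /andP[].
(* Translation by [s1 - f] moves the zero level of [G] to the level of [s1], which contains every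
   point of [S] off the facet. *)
exists (s1 - f); split=> [x /affF xZ|s sS].
  apply/(affP _ (Z := S)) => //; first by move=> y; apply: hats_sub.
  rewrite hatDB addmx_sub ?(submx_trans xZ (zeros_sub G S)) //.
  by rewrite addmx_sub ?eqmx_opp ?hats_sub.
have [Gs|Gs] := eqVneq (ev G s) 0.
  by left; apply/ZF; rewrite mem_filter Gs eqxx.
right; exists (s + (f - s1)); split; last by rewrite -addrA subrKA subrr addr0.
have Gss1 : ev G s = ev G s1.
  apply/eqP; rewrite eq_le !leNgt; apply/andP; split; apply/negP;
  exact: exact_two_values TG Z0 rk _ _ (gt0 _ _ _).
apply/affF; rewrite hatDB; apply: ker_zeros_sub.
- by rewrite rk.
- by exists s1.
- by rewrite !addmx_sub ?eqmx_opp ?hats_sub.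
- rewrite mulmxDl mulmxBl !ev_scalar Gss1 (ev_zeros fZ) raddf0 sub0r.
  by rewrite subrr.
Qed.

Lemma two_level_exact S :
  two_level S -> TH_exact (vanishing_ideal (fun x => x \in S)) 1.
Proof.
move=> lev; apply/exactP => p Tp; apply: subset_closure.
have pS := theta_body_span Tp.
have [//|[G0 G00 G0p]] := conv_or_separated S p.
have [G [Gge Gp rk]] := separating_facet pS G00 G0p.
have notall : ~ forall s, s \in S -> ev G s = 0.
  by move=> /ev_sub0/(_ pS) e; move: Gp; rewrite e ltxx.
(* Without zeros [S] would have rank one, so [p] would coincide with a point of [S], where [G] is
   nonnegative. *)
have Z0 : zeros G S != [::].
  apply/eqP => Z0; move: rk; rewrite Z0.
  have -> : \rank (hats [::] : 'M[R]_(0, 1 + n)) = 0%N.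
    by apply/eqP; rewrite -leqn0 rank_leq_row.
  move=> rS.
  have [s sS] : exists s, s \in S.
    case: (S) notall => [|s T _]; first by case.
    by exists s; rewrite mem_head.
  have : (hats S <= hat s)%MS.
    rewrite -(mxrank_leqif_sup (hats_sub sS)) rS rank_rV.
    suff -> : hat s != 0 by [].
    by apply/rV0Pn; exists 0; rewrite hat00 oner_eq0.
  move=> /(submx_trans pS)/sub_rVP[a /[dup] pE /rowP/(_ 0)].
  rewrite [RHS]mxE !hat00 mulr1 => a1; move: pE; rewrite -a1 scale1r => /hat_inj ps.
  by move: Gp; rewrite ps ltNge Gge.
pose F x := conv (fun x => x \in S) x /\ ev G x = 0.
have [v [_ vS]] : exists v,
       (forall x, aff F x -> aff (fun y => y \in S) (x + v)) /\
       (forall s, s \in S -> F s \/ exists x, aff F x /\ s = x + v).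
  by apply/lev/facetP; exists G.
have [ZF FZ] := @face_zeros _ _ S G F Gge (fun x => iff_refl _).
(* The linear part of [G] at [v], hence the value of [G] on the translate of [aff F]. *)
pose b := dotp (dsubmx G)^T v.
have bE s : s \in S -> ev G s = 0 \/ ev G s = b.
  move=> /vS[[_ ->]|[x [/(affP _ ZF FZ) xZ ->]]]; first by left.
  right; have := ev_sub0 (@ev_zeros _ _ G S) xZ; rewrite !ev_dotp => x0.
  rewrite -[RHS]add0r -x0 -addrA; congr (_ + _); rewrite /b /dotp -big_split.
  by apply: eq_bigr => i _; rewrite [(x + v) _ _]mxE mulrDr.
(* Otherwise [G], nonnegative on [S], would vanish on all of [S]. *)
have b0 : 0 < b.
  rewrite ltNge; apply/negP => b0; apply: notall => s sS.
  by case: (bE s sS) => // sb; apply/eqP; rewrite eq_le Gge // sb b0.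
move/theta_bodyP: Tp => /(_ G 1%N (fun=> (Num.sqrt b)^-1 *: G)) Tp.
suff /Tp : forall s, s \in S -> ev G s = \sum_(i < 1) ev ((Num.sqrt b)^-1 *: G) s ^+ 2.
  by rewrite leNgt Gp.
move=> s sS; rewrite big_ord1 evZ exprMn exprVn sqr_sqrtr ?(ltW b0) //.
case: (bE s sS) => ->; first by rewrite expr0n mulr0.
by rewrite expr2 mulKf ?gt_eqF.
Qed.

End Exactness.

Theorem mainTheorem15 (R : rcfType) (n : nat) (S : seq 'rV[R]_n) :
  TH_exact (vanishing_ideal (fun x => x \in S)) 1 <->
  (forall F : 'rV[R]_n -> Prop, facet (conv (fun x => x \in S)) F ->
     exists v : 'rV[R]_n,
       (forall x, aff F x -> aff (fun y => y \in S) (x + v)) /\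
       (forall s, s \in S -> F s \/ exists x, aff F x /\ s = x + v)).
Proof. by split; [apply: exact_two_level | apply: two_level_exact]. Qed.
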